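(* For $n\ge 0$ let $\mathrm{WI}_n$ be the number of $\Pi\in S^3_n$ whose vector of levels $(\mathrm{lev}(\Pi_1),\dots,\mathrm{lev}(\Pi_n))$ is weakly increasing, where $\mathrm{lev}$ is the maximal-entry level (defined in the context). Then \[\sum_{n\ge 0}\frac{\mathrm{WI}_n}{n!}x^n=\frac{1}{\cos(x)-\sin(x)}.\]
   Context: For $n\ge1$, $S_n$ denotes the set of permutations of $\{0,1,\dots,n-1\}$ written in one-line notation $\pi=\pi_1\pi_2\cdots\pi_n$. For $d\ge 2$, a $d$-dimensional permutation of length $n$ is an ordered $(d-1)$-tuple $\Pi=(\pi^2,\dots,\pi^d)$ with each $\pi^i=\pi^i_1\cdots\pi^i_n\in S_n$; $S^d_n$ denotes the set of these (for $n=0$ it consists of the single empty permutation). The elements of $\Pi$ are the columns $\Pi_j=(\pi^2_j,\pi^3_j,\dots,\pi^d_j)^T$, $1\le j\le n$. The level of an element is $\mathrm{lev}(\Pi_j)=\max\{\pi^2_j,\dots,\pi^d_j\}$ (the maximal entry of the column). *)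

(* Defs.v *)
From mathcomp Require Import all_boot all_order all_algebra all_fingroup.

Set Implicit Arguments.
Unset Strict Implicit.
Unset Printing Implicit Defensive.

Import GRing.Theory.
Local Open Scope ring_scope.

(* The entries of [P : dperm d n] are the permutations pi^2, ..., pi^d, so     *)
(* [tnth P i] is pi^(i+2); positions are numbered 0, ..., n-1.                *)
Notation dperm d n := (d.-1.-tuple 'S_n).

Definition lev (d n : nat) (P : dperm d n) (j : 'I_n) : nat :=
  \max_(i < d.-1) (tnth P i j : nat).

Definition levels (d n : nat) (P : dperm d n) : seq nat :=
  [seq lev P j | j <- enum 'I_n].

Definition WI (n : nat) : nat :=
  #|[set P : dperm 3 n | sorted leq (levels P)]|.

(* Formal power series over the rationals, as coefficient sequences compared  *)
(* by extensional equality [=1].                                              *)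
Definition fps : Type := nat -> rat.

Definition fps1 : fps := fun n => (n == 0%N)%:R.

Definition fps_sub (a b : fps) : fps := fun n => a n - b n.

Definition fps_mul (a b : fps) : fps :=
  fun n => \sum_(i < n.+1) a i * b (n - i)%N.

(* First n coefficients of 1 / a, obtained by solving (1 / a) * a = 1         *)
(* degree by degree; only meaningful when a 0 != 0 (see [fps_mulVf]).         *)
Fixpoint fps_inv_seq (a : fps) (n : nat) : seq rat :=
  if n is m.+1 then
    let s := fps_inv_seq a m in
    rcons s ((fps1 m - \sum_(i < m) s`_i * a (m - i)%N) / a 0%N)
  else [::].

Definition fps_inv (a : fps) : fps := fun n => (fps_inv_seq a n.+1)`_n.

Definition fps_div (a b : fps) : fps := fps_mul a (fps_inv b).

Definition fps_cos : fps :=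
  fun n => if odd n then 0 else (-1) ^+ n./2 / (n`!)%:R.

Definition fps_sin : fps :=
  fun n => if odd n then (-1) ^+ n./2 / (n`!)%:R else 0.

Definition egf (a : nat -> nat) : fps := fun n => (a n)%:R / (n`!)%:R.

Lemma size_fps_inv_seq (a : fps) (n : nat) : size (fps_inv_seq a n) = n.
Proof. by elim: n => //= n IHn; rewrite size_rcons IHn. Qed.

Lemma nth_fps_inv_seq (a : fps) (n i : nat) :
  (i < n)%N -> (fps_inv_seq a n)`_i = fps_inv a i.
Proof.
elim: n => // n IHn; rewrite ltnS leq_eqVlt => /predU1P[-> //|lt_in].
by rewrite /= nth_rcons size_fps_inv_seq lt_in IHn.
Qed.

Lemma fps_invE (a : fps) (n : nat) :
  fps_inv a n = (fps1 n - \sum_(i < n) fps_inv a i * a (n - i)%N) / a 0%N.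
Proof.
rewrite {1}/fps_inv /= nth_rcons size_fps_inv_seq ltnn eqxx.
by under eq_bigr => i _ do rewrite nth_fps_inv_seq //.
Qed.

Lemma fps_mulVf (a : fps) : a 0%N != 0 -> fps_mul (fps_inv a) a =1 fps1.
Proof.
move=> a0 n; rewrite /fps_mul big_ord_recr /= subnn [X in _ + X * _]fps_invE.
by rewrite divfK // addrC subrK.
Qed.

Lemma fps_cos_sub_sin0 : fps_sub fps_cos fps_sin 0%N != 0.
Proof. by []. Qed.

(* Main.v *)
(* Fix r = t s^-1, so that the level of column j is max(i, r i) with i = s_j.
   A level k occurs twice exactly when k is a cycle peak of r (r k < k and
   r^-1 k < k), so the words with a given r are ordered up to the relative
   order of the two columns of each peak: WI_n = \sum_r 2^(peaks r).
   Give r the weight x^(n - 2c) y^c, with c its number of peaks. Inserting a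
   new maximum in the cycles of r acts on the sum of these weights as the
   derivation x -> y, y -> 2xy plus multiplication by x (the new fixed point).
   As y - x^2 is a constant of this derivation we may put y = 1 + x^2, and
   WI_n is the value at x = 1, where y = 2, of M^n 1 for
   M p = (1 + x^2) p' + x p. The twisted operator M' q = (1 + x^2) q' - x q
   satisfies (1 + x^2)(p q)' = (M p) q + p (M' q) and M'^2 1 = -1, so the
   values of M'^n 1 at x = 1 are n! times the coefficients of cos - sin, and
   Leibniz's rule for the (vanishing) derivatives of 1 shows that the two
   exponential generating functions are inverse to each other. *)
From HB Require Import structures.
Require Import Defs.
From mathcomp Require Import all_boot all_order all_algebra all_fingroup.
From mathcomp Require Import ring zify.

Set Implicit Arguments.
Unset Strict Implicit.
Unset Printing Implicit Defensive.

Import GRing.Theory Num.Theory.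
Local Open Scope ring_scope.

(** * Sorted words and orderings by a key *)

Lemma sorted_enum_ordP (T : Type) (r : rel T) (n : nat) (f : 'I_n -> T) :
  transitive r ->
  reflect (forall i j : 'I_n, (i < j)%N -> r (f i) (f j))
          (sorted r [seq f j | j <- enum 'I_n]).
Proof.
move=> r_tr; apply: (iffP idP) => [s_f i j ltij|homo_f].
  have := @sorted_ltn_nth _ r r_tr (f i) _ s_f i j.
  rewrite !inE size_map size_enum_ord !ltn_ord => /(_ isT isT ltij).
  rewrite (nth_map i) ?size_enum_ord // (nth_map i) ?size_enum_ord //.
  by rewrite !nth_ord_enum.
have : sorted (fun i j : 'I_n => (i < j)%N) (enum 'I_n).
  by have := iota_ltn_sorted 0 n; rewrite -val_enum_ord sorted_map.
by apply: homo_sorted; exact: homo_f.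
Qed.

Lemma card_ord_lt (n : nat) (i : 'I_n) : #|[pred j : 'I_n | (j < i)%N]| = i.
Proof.
rewrite -sum1_card (eq_bigl (fun j : 'I_n => j < i)%N) //.
by rewrite (big_ord_narrow (ltnW (ltn_ord i))) sum1_card card_ord.
Qed.

(** The only such [s] is the inverse of the rank map, since it must list the elements by increasing
    key. *)
Lemma card_incr_perm (n : nat) (key : 'I_n -> nat) : injective key ->
  #|[set s : 'S_n | [forall i : 'I_n, forall j : 'I_n,
       (i < j)%N ==> (key (s i) < key (s j))%N]]|
    = 1%N.
Proof.
move=> key_inj.
pose rank a := #|[pred b | (key b < key a)%N]|.
have rank_mono a b : (key a < key b)%N -> (rank a < rank b)%N.
  move=> ltab; apply: proper_card; apply/properP; split.
    by apply/subsetP => c; rewrite !inE => /ltn_trans; apply.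
  by exists a; rewrite !inE ?ltnn.
have rank_lt a : (rank a < n)%N.
  rewrite -[X in (_ < X)%N]card_ord; apply: proper_card; apply/properP.
  by split; [exact/subsetP | exists a; rewrite ?inE ?ltnn].
have rank_inj : injective (fun a => Ordinal (rank_lt a)).
  move=> a b /(congr1 val) /= eq_r.
  by apply: key_inj; move: (@rank_mono a b) (@rank_mono b a); lia.
pose r := perm rank_inj.
apply/eqP/cards1P; exists r^-1%g; apply/setP => s; rewrite !inE.
apply/forallP/eqP => [s_incr|-> i].
  have {}s_incr (i j : 'I_n) : (i < j)%N -> (key (s i) < key (s j))%N.
    by move: (s_incr i) => /forallP/(_ j)/implyP.
  apply/permP => i; apply: (@perm_inj _ r); rewrite permKV permE.
  apply: val_inj => /=; rewrite /rank -[RHS]card_ord_lt.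
  rewrite -[RHS](card_image (@perm_inj _ s)); apply: eq_card => b.
  rewrite -[b](permKV s) mem_image ?inE; last exact: perm_inj.
  case: (ltngtP (s^-1%g b) i) => [/s_incr->//|/s_incr|/val_inj->];
    last exact: ltnn.
  by case: ltngtP.
apply/forallP => j; apply/implyP => ltij.
have rE a : r a = rank a :> nat by rewrite permE.
rewrite ltnNge leq_eqVlt; apply/negP => /predU1P[/key_inj/perm_inj|/rank_mono].
  by move=> eqij; rewrite eqij ltnn in ltij.
by rewrite -!rE !permKV; lia.
Qed.

(** * Cycle peaks and ties between levels *)

Definition cycle_peaks (n : nat) (s : 'S_n) : {set 'I_n} :=
  [set k | (s k < k)%N && (s^-1%g k < k)%N].

(* Splits ties in [i |-> maxn i (r i)], which occur only between [k] and
   [r^-1 k] for a cycle peak [k]: [k] comes first iff [k \in A]. *)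
Definition tie_key (n : nat) (r : 'S_n) (A : {set 'I_n}) (i : 'I_n) : nat :=
  if (i < r i)%N then (3 * r i + (if r i \in A then 2 else 0))%N
  else (3 * i + 1)%N.

(** Residues modulo 3 separate the two branches, and each branch is injective because [r] is. *)
Lemma tie_key_inj (n : nat) (r : 'S_n) (A : {set 'I_n}) :
  injective (tie_key r A).
Proof.
move=> i j; rewrite /tie_key.
case: (ltnP i (r i)) => _; case: (ltnP j (r j)) => _ e.
- apply: (@perm_inj _ r); apply: val_inj => /=; move: e.
  by case: (r i \in A); case: (r j \in A); lia.
- by move: e; case: (r i \in A); lia.
- by move: e; case: (r j \in A); lia.
by apply: val_inj => /=; lia.
Qed.

(** Each set [A] of peaks is [ties s] for exactly one such [s], namely the one increasing for
    [tie_key r A]. *)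
Lemma card_sorted_levels (n : nat) (r : 'S_n) :
  #|[set s : 'S_n | [forall i : 'I_n, forall j : 'I_n,
       (i < j)%N ==> (maxn (s i) (r (s i)) <= maxn (s j) (r (s j)))%N]]|
    = (2 ^ #|cycle_peaks r|)%N.
Proof.
pose ties (s : 'S_n) :=
  [set k in cycle_peaks r | (s^-1%g k < s^-1%g (r^-1%g k))%N].
rewrite -card_powerset -[RHS]sum1_card -sum1_card.
rewrite (partition_big ties (mem (powerset (cycle_peaks r)))) /=; last first.
  by move=> s _; rewrite inE; apply/subsetP => k; rewrite inE => /andP[].
apply: eq_bigr => A; rewrite inE => /subsetP sA.
rewrite sum1_card -[RHS](card_incr_perm (@tie_key_inj _ r A)).
apply: eq_card => s; rewrite [LHS]unfold_in !inE.
apply/andP/forallP => [[/forallP s_lev /eqP tiesA] i|s_key].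
  apply/forallP => j; apply/implyP => ltij.
  have := s_lev i => /forallP/(_ j)/implyP/(_ ltij).
  have neq : s i != s j by rewrite (inj_eq perm_inj) -val_eqE /= ltn_eqF.
  move: neq; rewrite /tie_key -tiesA !inE !permK.
  (* Positions become preimages so that [s i] and [s j] can be generalized. *)
  have -> : (s^-1%g (r (s i)) < i)%N =
      (s^-1%g (r (s i)) < s^-1%g (s i))%N by rewrite permK.
  have -> : (s^-1%g (r (s j)) < j)%N =
      (s^-1%g (r (s j)) < s^-1%g (s j))%N by rewrite permK.
  have : (s^-1%g (s i) < s^-1%g (s j))%N by rewrite !permK.
  move: (s i) (s j) => a b ltab neq.
  (* Levels tie only in the mixed cases, when [r a = b] or [a = r b]; there [ties s] decides. *)
  case: (ltnP a (r a)) => [lta|lea]; case: (ltnP b (r b)) => [ltb|leb] /=.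
  - have : r a != r b by rewrite (inj_eq perm_inj).
    rewrite -val_eqE /=; do 2!case: ifP; lia.
  - rewrite leq_eqVlt => /predU1P[eqab|]; last by case: ifP; lia.
    have {}eqab : r a = b by apply: val_inj => /=; lia.
    rewrite eqab (ltnNge _ (s^-1%g a)) (ltnW ltab) /= !andbF; lia.
  - rewrite leq_eqVlt => /predU1P[eqab|]; last by case: ifP; lia.
    have {}eqab : a = r b by apply: val_inj => /=; lia.
    have ltra : (r a < a)%N.
      rewrite ltn_neqAle lea andbT; apply: contraNneq neq => eqra.
      apply/eqP; apply: (@perm_inj _ r); rewrite -eqab.
      exact: val_inj.
    by rewrite -eqab ltab ltra /=; lia.
  - have := neq; rewrite -val_eqE /=; lia.
have {}s_key (i j : 'I_n) :
    (tie_key r A (s i) <= tie_key r A (s j))%N = (i <= j)%N.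
  have H (i1 j1 : 'I_n) :
      (i1 < j1)%N -> (tie_key r A (s i1) < tie_key r A (s j1))%N.
    by move: (s_key i1) => /forallP/(_ j1)/implyP.
  by case: (ltngtP i j) => [/H|/H|/val_inj->]; lia.
split.
  (* The quotient of a key by 3 is the level. *)
  apply/forallP => i; apply/forallP => j; apply/implyP => /ltnW.
  rewrite -s_key /tie_key; do 4?[case: ifP]; lia.
(* For a peak [k], the key [3k + 1] of [k] meets the key [3k + 2] or [3k] of [r^-1 k], according to
   [k \in A]. *)
apply/eqP/setP => k; rewrite inE ltnNge -s_key !permKV /tie_key !permKV.
have [Pk|Pk] := boolP (k \in cycle_peaks r); last first.
  by apply/esym/negbTE; apply: contraNN Pk; exact: sA.
move: Pk; rewrite inE => /andP[lt1 ->]; rewrite (ltnNge k) (ltnW lt1) /=.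
by case: (k \in A); lia.
Qed.

(** Writing the pair of permutations as [s] and [s * r] is bijective and makes the level at [j] the
    maximum of [s j] and [r (s j)]; one then counts for each fixed [r]. *)
Lemma WI_sum_peaks (n : nat) : WI n = (\sum_(r : 'S_n) 2 ^ #|cycle_peaks r|)%N.
Proof.
rewrite /WI -sum1_card.
pose pack (p : 'S_n * 'S_n) : dperm 3 n := [tuple p.2; (p.2 * p.1)%g].
pose unpack (P : dperm 3 n) :=
  (((tnth P ord0)^-1 * tnth P ord_max)%g, tnth P ord0).
have packK : cancel pack unpack.
  by case=> r s; rewrite /unpack /= !(tnth_nth 1%g) /= mulKg.
have unpackK : cancel unpack pack.
  move=> P; apply/eq_from_tnth => i; rewrite /pack /= mulKVg.
  by case: i => -[|[|//]] lti; rewrite [LHS](tnth_nth 1%g) /=;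
    congr tnth; apply: val_inj.
rewrite (reindex pack); last first.
  by exists unpack => ? _; [exact: packK | exact: unpackK].
rewrite (eq_bigl (fun p : 'S_n * 'S_n => p.2 \in [set s : 'S_n |
   [forall i : 'I_n, forall j : 'I_n,
     (i < j)%N ==> (maxn (s i) (p.1 (s i)) <= maxn (s j) (p.1 (s j)))%N]])).
  rewrite -(pair_big_dep predT (fun r s : 'S_n => s \in [set s : 'S_n | 
    [forall i : 'I_n, forall j : 'I_n,
     (i < j)%N ==> (maxn (s i) (r (s i)) <= maxn (s j) (r (s j)))%N]])
   (fun _ _ => 1%N)) /=.
  by apply: eq_bigr => r _; rewrite sum1_card card_sorted_levels.
case=> r s; rewrite !inE /levels.
have levE j : lev (pack (r, s)) j = maxn (s j) (r (s j)).
  by rewrite /lev big_ord_recl big_ord1 !(tnth_nth 1%g) /= permM.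
apply/(sorted_enum_ordP _ leq_trans)/forallP => [H i|H i j ltij].
  by apply/forallP => j; apply/implyP => /H; rewrite !levE.
by rewrite !levE; move: (H i) => /forallP/(_ j)/implyP/(_ ltij).
Qed.

(** * Inverse series and the iterated Leibniz rule *)

Lemma fps_inv_unique (a b : fps) :
  a 0%N != 0 -> fps_mul b a =1 fps1 -> b =1 fps_inv a.
Proof.
move=> a0 ba1; elim/ltn_ind => n IHn.
rewrite fps_invE -(ba1 n) /fps_mul big_ord_recr /= subnn addrC.
by under [X in _ + X - _]eq_bigr => i _ do rewrite IHn //; rewrite addrK mulfK.
Qed.

Lemma fps_div1 (a : fps) : fps_div fps1 a =1 fps_inv a.
Proof.
move=> n; rewrite /fps_div /fps_mul big_ord_recl big1 => [|i _].
  by rewrite mul1r addr0 subn0.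
by rewrite mul0r.
Qed.

(* [T i j] plays the role of [u^(i) v^(j)]. *)
Lemma iter_leibniz (R : pzRingType) (N : {additive R -> R})
    (T : nat -> nat -> R) :
  (forall i j, N (T i j) = T i.+1 j + T i j.+1) ->
  forall n, iter n N (T 0 0)%N = \sum_(i < n.+1) T i (n - i)%N *+ 'C(n, i).
Proof.
move=> NT; elim=> [|n IHn]; first by rewrite big_ord1.
rewrite iterS {}IHn raddf_sum.
under eq_bigr => i _ do rewrite raddfMn NT mulrnDl -subSn -1?ltnS //.
rewrite big_split /= [in RHS]big_ord_recl bin0 /=.
(* Pascal's rule splits the right side into the two sums on the left. *)
under [in RHS]eq_bigr => i _ do rewrite /bump /= add1n binS mulrnDr subSS.
rewrite big_split /= addrC [X in X + _ = _]big_ord_recl bin0 -addrA subn0.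
congr (_ + (_ + _)).
rewrite [in RHS]big_ord_recr /= bin_small // mulr0n addr0.
apply: eq_bigr => i _.
by rewrite /bump /= add1n subSS.
Qed.

(** * Twisted derivations and the coefficients of cos - sin *)

Definition riccati_der (p : {poly rat}) : {poly rat} := (1 + 'X^2) * p^`().

Lemma riccati_der_is_additive : zmod_morphism riccati_der.
Proof. by move=> p q; rewrite /riccati_der derivB mulrBr. Qed.

HB.instance Definition _ :=
  GRing.isZmodMorphism.Build _ _ riccati_der riccati_der_is_additive.

(** For x = tan t, [riccati_der] is d/dt, and [sec_der], [cos_der] act on p when sec t p(x), cos t
    p(x) are differentiated. Evaluation at 1 means t = pi/4. *)
Definition sec_der (p : {poly rat}) := riccati_der p + 'X * p.
Definition cos_der (p : {poly rat}) := riccati_der p - 'X * p.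

(** The two twists cancel, reflecting sec t cos t = 1. *)
Lemma riccati_derM (p q : {poly rat}) :
  riccati_der (p * q) = sec_der p * q + p * cos_der q.
Proof. by rewrite /sec_der /cos_der /riccati_der derivM; ring. Qed.

(** Applying [cos_der] twice negates both 1 and [- 'X], so the induction goes in steps of two. *)
Lemma iter_cos_der (n : nat) :
  iter n cos_der 1 = (-1) ^+ n./2 * (if odd n then - 'X else 1).
Proof.
elim/ltn_ind: n => -[|[|n]] IHn; first by rewrite mulr1.
  by rewrite /= /cos_der /riccati_der derivC; ring.
rewrite /= {}IHn ?leqnSn // negbK exprS.
have -> : (-1) ^+ n./2 = ((-1) ^+ n./2)%:P :> {poly rat}.
  by rewrite rmorphXn rmorphN1.
by case: (odd n); rewrite /cos_der /riccati_der ?derivE; ring.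
Qed.

Lemma sec_cos_convolution (n : nat) :
  \sum_(i < n.+1) (iter i sec_der 1).[1] * (iter (n - i) cos_der 1).[1]
     *+ 'C(n, i) = (n == 0%N)%:R.
Proof.
have NT i j : riccati_der (iter i sec_der 1 * iter j cos_der 1) =
    iter i.+1 sec_der 1 * iter j cos_der 1 +
    iter i sec_der 1 * iter j.+1 cos_der 1 by exact: riccati_derM.
have /(congr1 (horner^~ 1)) := iter_leibniz NT n.
rewrite horner_sum; under eq_bigr => i _ do rewrite hornerMn hornerM.
move=> <-; case: n => [|n]; first by rewrite /= mulr1 hornerC.
rewrite iterSr /= mulr1 {2}/riccati_der derivC mulr0.
suff -> : iter n riccati_der 0 = 0 by rewrite horner0.
by elim: n => //= n ->; rewrite raddf0.
Qed.

Lemma fps_cos_sub_sinE (n : nat) :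
  fps_sub fps_cos fps_sin n = (iter n cos_der 1).[1] / (n`!)%:R.
Proof.
rewrite iter_cos_der /fps_sub /fps_cos /fps_sin.
have -> : (-1) ^+ n./2 = ((-1) ^+ n./2)%:P :> {poly rat}.
  by rewrite rmorphXn rmorphN1.
by case: (odd n); rewrite !hornerE; ring.
Qed.

Lemma egf_mul_cos_sub_sin (a : nat -> nat) :
  (forall n, (a n)%:R = (iter n sec_der 1).[1] :> rat) ->
  fps_mul (egf a) (fps_sub fps_cos fps_sin) =1 fps1.
Proof.
move=> aE n.
have f0 m : (m`!)%:R != 0 :> rat by rewrite pnatr_eq0 -lt0n fact_gt0.
have -> : fps1 n = (n == 0%N)%:R / (n`!)%:R.
  by case: n => [|n]; rewrite /fps1 ?divr1 ?mul0r.
(* Termwise, ['C(n, i)] over n! is the inverse of i! (n - i)!. *)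
rewrite -sec_cos_convolution mulr_suml; apply: eq_bigr => -[i /= ltin] _.
rewrite fps_cos_sub_sinE /egf aE -(bin_fact (n := n) (m := i)) //
  !natrM -mulr_natr.
by field; rewrite !f0 pnatr_eq0 -lt0n bin_gt0.
Qed.

(** With m = n - 2c the terms match inserting a maximum as a fixed point, at one of 2c places
    creating no further peak, or at one of m places creating one. At m = 0 the truncated [m.-1] has
    multiplicity 0. *)
Lemma sec_der_monomial (m c : nat) :
  sec_der ('X^m * (1 + 'X^2) ^+ c : {poly rat}) =
    'X^(m.+1) * (1 + 'X^2) ^+ c + ('X^(m.+1) * (1 + 'X^2) ^+ c) *+ (2 * c)
    + ('X^(m.-1) * (1 + 'X^2) ^+ c.+1) *+ m.
Proof.
rewrite /sec_der /riccati_der derivM [(_ ^+ c)^`()]deriv_exp !derivE.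
case: m c => [|m] [|c]; rewrite /= ?(expr0, exprS) ?mulr0n; ring.
Qed.

(** * Inserting a new maximum into the cycles *)

Lemma cycle_peaks_disjoint (n : nat) (s : 'S_n) :
  [disjoint cycle_peaks s & s @: cycle_peaks s].
Proof.
apply/pred0P => k /=; apply/negP => /andP[Pk /imsetP[l Pl ekl]].
by move: Pk Pl; rewrite !inE ekl permK; lia.
Qed.

Lemma double_cycle_peaks (n : nat) (s : 'S_n) :
  #|cycle_peaks s :|: s @: cycle_peaks s| = (2 * #|cycle_peaks s|)%N.
Proof.
rewrite cardsU (card_imset _ perm_inj) mul2n -addnn.
by move/disjoint_setI0: (cycle_peaks_disjoint s) => ->; rewrite cards0 subn0.
Qed.

(** The maximum enters its cycle just before [p.2], or is fixed if [p.2] is [ord_max]. *)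
Definition insert_max (n : nat) (p : 'S_n * 'I_n.+1) : 'S_n.+1 :=
  (lift_perm ord_max ord_max p.1 * tperm ord_max p.2)%g.

Lemma insert_max_bij (n : nat) : bijective (@insert_max n).
Proof.
apply: inj_card_bij; last by rewrite card_prod !card_Sn card_ord factS mulnC.
move=> [s i] [t j] /= e; have eij : i = j.
  have /permP/(_ ord_max) := e.
  by rewrite /insert_max !permM !lift_perm_id !tpermL.
congr (_, _) => //; move: e; rewrite eij => /mulIg/permP e.
apply/permP => k; have := e (lift ord_max k).
by rewrite !lift_perm_lift => /lift_inj.
Qed.

Lemma cycle_peaks_insert_fixed (n : nat) (s : 'S_n) :
  #|cycle_peaks (insert_max (s, ord_max))| = #|cycle_peaks s|.
Proof.
suff -> : cycle_peaks (insert_max (s, ord_max)) = lift ord_max @: cycle_peaks s.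
  exact/card_imset/lift_inj.
apply/setP => k; rewrite inE /insert_max /= tperm1 mulg1 lift_permV.
case: (unliftP ord_max k) => [l ->|->].
  by rewrite !lift_perm_lift (mem_imset _ _ lift_inj) !inE !lift_max.
rewrite !lift_perm_id ltnn /=; apply/esym/negP => /imsetP[l _ /eqP].
by rewrite (negbTE (neq_lift _ _)).
Qed.

(** The maximum lands between [s^-1 j] and [j]: it becomes a peak, and these two, of which at most
    one was a peak, are none afterwards. *)
Lemma cycle_peaks_insert_lift (n : nat) (s : 'S_n) (j : 'I_n) :
  #|cycle_peaks (insert_max (s, lift ord_max j))|
    = ((j \notin cycle_peaks s :|: s @: cycle_peaks s) + #|cycle_peaks s|)%N.
Proof.
have -> : cycle_peaks (insert_max (s, lift ord_max j)) =
    ord_max |: lift ord_max @: (cycle_peaks s :\ j :\ s^-1%g j).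
  apply/setP => k; rewrite !inE /insert_max /= invMg tpermV !permM lift_permV.
  case: (unliftP ord_max k) => [l ->|->]; last first.
    rewrite tpermL lift_perm_id lift_perm_lift tpermL eqxx !lift_max.
    by rewrite !ltn_ord.
  rewrite lift_perm_lift (mem_imset _ _ lift_inj) !inE eq_sym.
  rewrite (negbTE (neq_lift _ _)) /= [bump n l]lift_max.
  have [->|nlj] := eqVneq l j.
    by rewrite tpermR lift_perm_id /=
      [(n < j)%N]ltnNge (ltnW (ltn_ord j)) /= !andbF.
  rewrite [X in lift_perm _ _ _ X]tpermD ?neq_lift //; last first.
    by rewrite (inj_eq lift_inj) eq_sym.
  rewrite lift_perm_lift !lift_max -(inj_eq (@perm_inj _ s)) permKV.
  have [eslj|nslj] := eqVneq (s l) j.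
    by rewrite eslj tpermR [X in X && _]ltnNge ltnW //= ltn_ord.
  by rewrite tpermD ?neq_lift ?(inj_eq lift_inj) 1?eq_sym // lift_max.
rewrite cardsU1 (card_imset _ lift_inj).
have -> : (ord_max \notin lift ord_max @: (cycle_peaks s :\ j :\ s^-1%g j)).
  by apply/negP => /imsetP[l _ /eqP]; rewrite (negbTE (neq_lift _ _)).
have Ej : (j \in s @: cycle_peaks s) = (s^-1%g j \in cycle_peaks s).
  by rewrite -{1}[j](permKV s) (mem_imset _ _ perm_inj).
have := disjointFr (cycle_peaks_disjoint s) (x := j); rewrite Ej => Dj.
have := cardsD1 j (cycle_peaks s).
have := cardsD1 (s^-1%g j) (cycle_peaks s :\ j).
rewrite in_setD1 in_setU Ej.
(* A peak is not fixed, so removing [j] does not already remove [s^-1 j]. *)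
have : s^-1%g j \in cycle_peaks s -> s^-1%g j != j.
  by rewrite inE permKV => /andP[+ _]; apply: contraTneq => ->; rewrite ltnn.
case: (boolP (j \in _)) Dj => [_ -> // _|_ _] /=;
  first by rewrite andbF => -> ->.
by case: (s^-1%g j \in _) => [/(_ isT) ->|_]; rewrite ?andbF /= => -> ->.
Qed.

Lemma sum_peak_monomial (n : nat) :
  \sum_(s : 'S_n) 'X^(n - 2 * #|cycle_peaks s|) *
     (1 + 'X^2) ^+ #|cycle_peaks s| = iter n sec_der 1.
Proof.
elim: n => [|n IHn].
  rewrite (big_pred1 1%g) => [|s]; last by apply/esym/eqP/permP => -[].
  by rewrite eq_card0 ?mulr1 // => -[].
rewrite (reindex _ (onW_bij _ (insert_max_bij n))) /=.
rewrite -(pair_bigA _ (fun s j =>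
   'X^(n.+1 - 2 * #|cycle_peaks (insert_max (s, j))|) *
   (1 + 'X^2) ^+ #|cycle_peaks (insert_max (s, j))|)) /=.
rewrite -IHn /sec_der raddf_sum mulr_sumr -big_split /=; apply: eq_bigr => s _.
rewrite -/(sec_der _) sec_der_monomial.
have := double_cycle_peaks s.
move: (cycle_peaks s :|: _) (cycle_peaks_insert_lift s) => Q Q_ins cardQ.
rewrite big_ord_recr /=.
(* This makes the truncated subtraction in the exponent exact. *)
have le2c : (2 * #|cycle_peaks s| <= n)%N.
  by rewrite -cardQ -[leqRHS]card_ord max_card.
rewrite cycle_peaks_insert_fixed (subSn le2c) [LHS]addrC -[RHS]addrA;
  congr (_ + _).
have insE (i : 'I_n) :
    #|cycle_peaks (insert_max (s, widen_ord (leqnSn n) i))|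
      = ((i \notin Q) + #|cycle_peaks s|)%N.
  rewrite -Q_ins; congr #|cycle_peaks (insert_max (s, _))|.
  exact/val_inj/esym/lift_max.
under eq_bigr => i _ do rewrite insE.
(* Places in [Q] keep the number of peaks; the n - 2c others raise it by one. *)
rewrite (bigID (mem Q)) /=; congr (_ + _).
  rewrite (eq_bigr (fun=>
    'X^((n - 2 * #|cycle_peaks s|).+1) * (1 + 'X^2) ^+ #|cycle_peaks s|)).
    by rewrite sumr_const cardQ.
  by move=> i ->; rewrite add0n subSn.
rewrite (eq_bigr (fun=>
  'X^((n - 2 * #|cycle_peaks s|).-1) * (1 + 'X^2) ^+ #|cycle_peaks s|.+1)).
  rewrite sumr_const; congr (_ *+ _).
  apply/eqP; rewrite -(eqn_add2l (2 * #|cycle_peaks s|)) subnKC //.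
  by have /eqP := cardC (mem Q); rewrite card_ord cardQ.
by move=> i ->; rewrite add1n mulnS !addSn subSS subnS.
Qed.

Lemma WI_sec_der (n : nat) : (WI n)%:R = (iter n sec_der 1).[1] :> rat.
Proof.
rewrite WI_sum_peaks -sum_peak_monomial horner_sum natr_sum.
apply: eq_bigr => s _.
(* At 1 the factor [1 + 'X^2] is 2 and powers of ['X] are 1. *)
by rewrite natrX !(hornerE, horner_exp) !expr1n mul1r.
Qed.

Theorem theorem3p9 :
  egf WI =1 fps_div fps1 (fps_sub fps_cos fps_sin).
Proof.
move=> n; rewrite fps_div1; move: n.
apply: fps_inv_unique fps_cos_sub_sin0 _.
exact: egf_mul_cos_sub_sin WI_sec_der.
Qed.
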